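(* For each integer $q\geq 4$, there exist a real constant $c>1$ and infinitely many $K_q$-divisible graphs $G$ with minimum degree $\delta(G)\geq \left(1-\frac{1}{c\cdot (q+1)}\right)v(G)$ such that $G$ has no $K_q$-decomposition and even no fractional $K_q$-decomposition.
   Context: Graphs are finite, simple and undirected, and ''infinitely many'' is understood up to isomorphism. For a graph $G$, $v(G)$ and $e(G)$ denote its numbers of vertices and edges, $d_G(x)$ the degree of a vertex $x$, and $\delta(G)$ the minimum degree. A graph $G$ is $K_q$-divisible if $\binom{q}{2}$ divides $e(G)$ and $q-1$ divides $d_G(x)$ for every vertex $x\in V(G)$. A $K_q$-decomposition of $G$ is a partition of the edge set of $G$ into (edge sets of) edge-disjoint copies of $K_q$ in $G$. A fractional $K_q$-decomposition of $G$ is an assignment of non-negative real weights to the copies of $K_q$ in $G$ such that for every edge $e$ of $G$, the total weight of the copies of $K_q$ containing $e$ is exactly $1$. *)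

(* Defs.v *)
From HB Require Import structures.
From mathcomp Require Import all_boot all_order all_algebra reals.

Set Implicit Arguments.
Unset Strict Implicit.
Unset Printing Implicit Defensive.

Import Order.TTheory GRing.Theory Num.Theory.

Record sgraph := SGraph {
  vertex :> finType;
  adj : rel vertex;
  adj_sym : symmetric adj;
  adj_irrefl : irreflexive adj
}.

Definition isomorphic (G H : sgraph) : Prop :=
  exists f : G -> H, bijective f /\ forall x y : G, adj (f x) (f y) = adj x y.

Definition infinitely_many (P : sgraph -> Prop) : Prop :=
  exists G : nat -> sgraph,
    (forall i, P (G i)) /\ (forall i j, i <> j -> ~ isomorphic (G i) (G j)).

Definition edges (G : sgraph) : {set {set G}} :=
  [set [set x; y] | x in G, y in G & adj x y].

Definition degree (G : sgraph) (x : G) : nat := #|[set y | adj x y]|.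

(* Every degree is less than #|G|, so for a nonempty graph the default value  *)
(* plays no role; for the graph without vertices it makes the result 0.       *)
Definition min_degree (G : sgraph) : nat := \big[minn/#|G|]_(x : G) degree x.

(* A copy of K_q in G is determined by its vertex set, so copies are encoded  *)
(* as sets of q pairwise adjacent vertices.                                   *)
Definition Kcopies (q : nat) (G : sgraph) : {set {set G}} :=
  [set K : {set G} | (#|K| == q)
     && [forall x in K, forall y in K, (x != y) ==> adj x y]].

Definition copy_edges (G : sgraph) (K : {set G}) : {set {set G}} :=
  [set e in edges G | e \subset K].

Definition Kdivisible (q : nat) (G : sgraph) : Prop :=
  'C(q, 2) %| #|edges G| /\ forall x : G, q - 1 %| degree x.

Definition has_Kdecomposition (q : nat) (G : sgraph) : Prop :=
  exists P : {set {set {set G}}}, partition P (edges G) /\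
    forall B, B \in P -> exists2 K, K \in Kcopies q G & B = copy_edges K.

Definition has_fractional_Kdecomposition (R : realType) (q : nat)
    (G : sgraph) : Prop :=
  exists w : {set G} -> R,
    (forall K, K \in Kcopies q G -> (0 <= w K)%R) /\
    (forall e, e \in edges G ->
       (\sum_(K in Kcopies q G | e \in copy_edges K) w K = 1)%R).

(* Main.v *)
(* Let k = q - 3. The counterexample is a join of k independent sets of equal
   size (with union A) and two regular graphs on parts B and C, all sizes and
   degrees chosen so that the whole graph is regular. Infeasibility of the
   fractional decomposition is shown by a dual certificate: weights 0, 1, -1, k,
   -k, 3k on the edges of type AA, AB, AC, BB, BC, CC. A copy of K_q with
   a <= k, b, c vertices in A, B, C has nonnegative weight, whereas the whole
   graph has negative weight for |B| = 77, |C| = 65 and independent sets of size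
   35. The perturbation |B| <> |C| of the balanced sizes is what pushes the
   degree beyond 1 - 1/(q + 1): the number of vertices is then 35q + 37
   instead of 35(q + 1). *)
Require Import Defs.
From HB Require Import structures.
From mathcomp Require Import all_boot all_order all_algebra reals.
From mathcomp Require Import zify ring.

Set Implicit Arguments.
Unset Strict Implicit.
Unset Printing Implicit Defensive.

Import Order.TTheory GRing.Theory Num.Theory.

(** * Edges, copies of the clique and decompositions *)

Lemma isomorphic_card (G H : sgraph) : isomorphic G H -> #|G| = #|H|.
Proof. by case=> f [fbij _]; apply: bij_eq_card fbij. Qed.

Lemma edgesP (G : sgraph) (e : {set G}) :
  reflect (exists x y, adj x y /\ e = [set x; y]) (e \in edges G).
Proof.
apply: (iffP imset2P) => [[x y _ /[!inE] /= xy ->]|[x [y [xy ->]]]].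
  by exists x, y.
by apply: (Imset2spec (x1 := x) (x2 := y)); rewrite // inE.
Qed.

Lemma adj_neq (G : sgraph) (x y : G) : adj x y -> x != y.
Proof. by apply: contraTneq => ->; rewrite adj_irrefl. Qed.

(** Ordered adjacent pairs are grouped by the edge they span; each edge arises from exactly two of
    them. *)
Lemma handshake (G : sgraph) : \sum_(x : G) degree x = #|edges G|.*2.
Proof.
have -> : \sum_(x : G) degree x = \sum_(p : G * G | adj p.1 p.2) 1.
  rewrite -(pair_big_dep predT (fun x y : G => adj x y) (fun _ _ => 1)) /=.
  apply: eq_bigr => x _; rewrite /degree -sum1_card.
  by apply: eq_bigl => y; rewrite inE.
rewrite (partition_big (fun p : G * G => [set p.1; p.2]) (mem (edges G))) /=; last first.
  by move=> [x y] /= xy; apply/edgesP; exists x, y.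
rewrite -muln2 -sum_nat_const; apply: eq_bigr => e /edgesP[x [y [xy ->]]].
transitivity (\sum_(p in [set (x, y); (y, x)]) 1); last first.
  by rewrite sum1_card cards2 xpair_eqE (negbTE (adj_neq xy)).
apply: eq_bigl => -[u v]; rewrite !inE !xpair_eqE /=.
apply/andP/idP => [[uv /eqP E]|].
  have : u \in [set x; y] by rewrite -E set21.
  have : v \in [set x; y] by rewrite -E set22.
  have := adj_neq uv; rewrite !inE.
  by move=> /[swap] /orP[] /eqP-> /[swap] /orP[] /eqP->; rewrite !eqxx ?orbT.
by case/orP => /andP[/eqP-> /eqP->]; split; rewrite // ?(adj_sym y) // setUC.
Qed.

Lemma Kcopy_adj q (G : sgraph) (K : {set G}) x y :
  K \in Kcopies q G -> x \in K -> y \in K -> x != y -> adj x y.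
Proof.
by rewrite inE => /andP[_ /forall_inP KP] xK yK; apply/implyP/(forall_inP (KP x xK)).
Qed.

Lemma copy_edgesP q (G : sgraph) (K : {set G}) x y :
  K \in Kcopies q G -> adj x y ->
  ([set x; y] \in copy_edges K) = (x \in K) && (y \in K).
Proof.
move=> KK xy; rewrite inE subUset !sub1set andb_idl // => _.
by apply/edgesP; exists x, y.
Qed.

(** For [2 <= q] every vertex of a copy lies on one of its edges, so a copy is recovered from its
    edge set. *)
Lemma copy_edges_sub q (G : sgraph) (K L : {set G}) :
  2 <= q -> K \in Kcopies q G -> copy_edges K \subset copy_edges L -> K \subset L.
Proof.
move=> q2 KK /subsetP sKL; apply/subsetP => x xK.
have /set0Pn[y] : K :\ x != set0.
  rewrite -card_gt0; have := cardsD1 x K; rewrite xK.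
  by move: KK; rewrite inE => /andP[/eqP-> _]; lia.
rewrite !inE eq_sym => /andP[xy yK].
have : [set x; y] \in copy_edges L.
  by apply: sKL; rewrite (copy_edgesP KK) ?xK //; apply: (Kcopy_adj KK).
by rewrite inE subUset sub1set => /and3P[].
Qed.

(** Copies whose edge set is a block get weight 1, all others 0. *)
Lemma fractional_of_decomposition (R : realType) q (G : sgraph) :
  2 <= q -> has_Kdecomposition q G -> has_fractional_Kdecomposition R q G.
Proof.
move=> q2 [P [/and3P[/eqP covP trivP _] PK]].
exists (fun K => (copy_edges K \in P)%:R)%R; split=> [K _|e eE].
  exact: ler0n.
have /bigcupP[B BP eB] : e \in cover P by rewrite covP.
have [K KK defB] := PK B BP.
(* Blocks are disjoint, so another copy of weight 1 through [e] would have the edges of [K], hence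
   equal [K]. *)
rewrite (bigD1 K) /=; last by rewrite KK -defB.
rewrite -defB BP big1 ?addr0 // => L /andP[/andP[LK eL] neqLK].
case: (boolP (_ \in P)) => // LP; case/eqP: neqLK.
have eqLB : copy_edges L = copy_edges K.
  by rewrite -defB -(def_pblock trivP LP eL) (def_pblock trivP BP eB).
by apply/eqP; rewrite eqEsubset !(@copy_edges_sub q) // eqLB.
Qed.

Local Open Scope ring_scope.

(** * Weak linear programming duality *)

(** Double counting: a fractional decomposition would write the total of [g] as a nonnegative
    combination of its totals on copies. Each edge is counted in both directions. *)
Lemma no_fractional_Kdecomposition (R : realType) q (G : sgraph) (g : G -> G -> int) :
  (forall K, K \in Kcopies q G -> 0 <= \sum_(x in K) \sum_(y in K | x != y) g x y) ->
  \sum_(x : G) \sum_(y | adj x y) g x y < 0 ->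
  ~ has_fractional_Kdecomposition R q G.
Proof.
move=> gK g_lt0 [w [w0 w1]]; move: g_lt0; apply/negP; rewrite -leNgt -(ler0z R).
have -> : (\sum_(x : G) \sum_(y | adj x y) g x y)%:~R =
    \sum_(K in Kcopies q G) w K * (\sum_(x in K) \sum_(y in K | x != y) g x y)%:~R.
  (* The weights through an edge add up to 1, so [g x y] is spread over the copies containing it.
     The conditional makes the range of [K] independent of [x] and [y], which allows exchanging the
     sums. *)
  transitivity (\sum_(x : G) \sum_(y | adj x y)
     \sum_(K in Kcopies q G) (if (x \in K) && (y \in K) then w K * (g x y)%:~R else 0)).
    rewrite rmorph_sum /=; apply: eq_bigr => x _.
    rewrite rmorph_sum /=; apply: eq_bigr => y xy.
    rewrite -big_mkcondr -mulr_suml -[LHS]mul1r; congr (_ * _).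
    rewrite -(w1 [set x; y]); last by apply/edgesP; exists x, y.
    apply: eq_bigl => K; case: (boolP (_ \in Kcopies _ _)) => //= KK.
    by rewrite (copy_edgesP KK).
  rewrite (eq_bigr (fun x => \sum_(K in Kcopies q G) \sum_(y | adj x y)
      (if (x \in K) && (y \in K) then w K * (g x y)%:~R else 0))); last first.
    by move=> x _; rewrite exchange_big.
  rewrite exchange_big; apply: eq_bigr => K KK /=.
  rewrite rmorph_sum mulr_sumr [RHS]big_mkcond; apply: eq_bigr => x _.
  case: (boolP (x \in K)) => xK /=; last by rewrite big1.
  rewrite rmorph_sum mulr_sumr -big_mkcondr /=.
  apply: eq_bigl => y; case: (boolP (y \in K)) => yK; rewrite ?andbF //= andbT.
  by apply/idP/idP => [/adj_neq|/(Kcopy_adj KK xK yK)].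
by apply: sumr_ge0 => K KK; rewrite mulr_ge0 ?w0 // ler0z gK.
Qed.

(** * The graphs: independent sets joined with two blown-up circulants *)

(** The truncated differences add up to |i - j|; the two bounds say that the cyclic distance modulo
    [s] exceeds [r]. *)
Definition arc (s r i j : nat) : bool := (r < (i - j) + (j - i) < s - r)%N.

(* The parts of [cgraph k m] are k independent sets of size 35m, jointly "A"; a
   set B of size 77m carrying the 7m-fold blow-up of a circulant on 11 points;
   and a set C of size 65m carrying the 5m-fold blow-up of a circulant on 13
   points. Every vertex has exactly 35m non-neighbours, itself included. *)
Definition cvertex (k m : nat) : finType :=
  ('I_k * 'I_(35 * m) + ('I_11 * 'I_(7 * m) + 'I_13 * 'I_(5 * m)))%type.

Definition cadj k m (x y : cvertex k m) : bool :=
  match x, y with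
  | inl u, inl v => u.1 != v.1
  | inr (inl u), inr (inl v) => arc 11 2 u.1 v.1
  | inr (inr u), inr (inr v) => arc 13 3 u.1 v.1
  | _, _ => true
  end.

Lemma arc_sym s r i j : arc s r i j = arc s r j i.
Proof. by rewrite /arc addnC. Qed.

Lemma cadj_sym k m : symmetric (@cadj k m).
Proof.
move=> [u|[u|u]] [v|[v|v]] //; [|exact: arc_sym..].
by congr negb; apply: eq_sym.
Qed.

Lemma cadj_irrefl k m : irreflexive (@cadj k m).
Proof.
case=> [u|[u|u]]; first exact/negbF/eqxx.
  by rewrite /cadj /arc subnn.
by rewrite /cadj /arc subnn.
Qed.

Definition cgraph k m : sgraph := SGraph (@cadj_sym k m) (@cadj_irrefl k m).

(** * Part indicators, neighbour counts and degrees *)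

Definition inA k m (x : cvertex k m) : int := if x is inl _ then 1 else 0.
Definition inB k m (x : cvertex k m) : int := if x is inr (inl _) then 1 else 0.
Definition inC k m (x : cvertex k m) : int := if x is inr (inr _) then 1 else 0.

Lemma sum_pair_const s t (P : pred 'I_s) :
  \sum_(p : 'I_s * 'I_t | P p.1) (1 : int) = #|P|%:Z * t%:Z.
Proof.
rewrite (eq_bigl [predX P & predT]) => [|p]; last by rewrite inE andbT.
by rewrite sumr_const cardX card_ord natz.
Qed.

Lemma big_cvertex k m (P : pred (cvertex k m)) (F : cvertex k m -> int) :
  \sum_(x | P x) F x = \sum_(u | P (inl u)) F (inl u) +
    (\sum_(u | P (inr (inl u))) F (inr (inl u)) +
     \sum_(u | P (inr (inr u))) F (inr (inr u))).
Proof. by rewrite big_sumType big_sumType. Qed.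

(** Neighbours are at cyclic distance 3, 4 or 5. After the blow-up, degrees inside B are 42m = 77m -
    35m. *)
Lemma card_arc_11 (i : 'I_11) : #|[pred j : 'I_11 | arc 11 2 i j]| = 6.
Proof.
transitivity (\sum_(0 <= j < 11 | arc 11 2 i j) 1)%N.
  by rewrite big_mkord -sum1_card.
by case: i => i /=; do 11!(case: i => [_|i] /=; first by rewrite unlock).
Qed.

(** Neighbours are at cyclic distance 4, 5 or 6. After the blow-up, degrees inside C are 30m = 65m -
    35m. *)
Lemma card_arc_13 (i : 'I_13) : #|[pred j : 'I_13 | arc 13 3 i j]| = 6.
Proof.
transitivity (\sum_(0 <= j < 13 | arc 13 3 i j) 1)%N.
  by rewrite big_mkord -sum1_card.
by case: i => i /=; do 13!(case: i => [_|i] /=; first by rewrite unlock).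
Qed.

Lemma sum_inA k m : \sum_(x : cvertex k m) inA x = k%:Z * (35 * m%:Z).
Proof.
by rewrite big_cvertex /= (sum_pair_const _ predT) !big1 // card_ord !addr0.
Qed.

Lemma sum_inB k m : \sum_(x : cvertex k m) inB x = 11 * (7 * m%:Z).
Proof.
by rewrite big_cvertex /= (sum_pair_const _ predT) !big1 // card_ord addr0 add0r.
Qed.

Lemma sum_inC k m : \sum_(x : cvertex k m) inC x = 13 * (5 * m%:Z).
Proof.
by rewrite big_cvertex /= (sum_pair_const _ predT) !big1 // card_ord !add0r.
Qed.

Lemma inABC k m (x : cvertex k m) : inA x + inB x + inC x = 1.
Proof. by case: x => [u|[u|u]]. Qed.

Lemma nbr_inA k m (x : cvertex k m) :
  \sum_(y | cadj x y) inA y = (k%:Z - inA x) * (35 * m%:Z).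
Proof.
case: x => [u|[u|u]]; rewrite big_cvertex /= ?(sum_pair_const _ predT) ?card_ord.
- rewrite (sum_pair_const _ (fun j => u.1 != j)) !big1 // !addr0 PoszM.
  congr (_ * _); rewrite (eq_card (B := predC1 u.1)) => [|j]; last first.
    by rewrite !inE eq_sym.
  by rewrite cardC1 card_ord; case: k u => [[[]]|k _] //; lia.
- by rewrite !big1 // !addr0 PoszM.
- by rewrite !big1 // !addr0 PoszM.
Qed.

Lemma nbr_inB k m (x : cvertex k m) :
  \sum_(y | cadj x y) inB y = 77 * m%:Z - inB x * (35 * m%:Z).
Proof.
case: x => [u|[u|u]]; rewrite big_cvertex /= ?(sum_pair_const _ predT) ?card_ord.
- by rewrite !big1 //; lia.
- by rewrite (sum_pair_const _ [pred j : 'I_11 | arc 11 2 u.1 j]) card_arc_11 !big1 //; lia.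
- by rewrite !big1 //; lia.
Qed.

Lemma nbr_inC k m (x : cvertex k m) :
  \sum_(y | cadj x y) inC y = 65 * m%:Z - inC x * (35 * m%:Z).
Proof.
case: x => [u|[u|u]]; rewrite big_cvertex /= ?(sum_pair_const _ predT) ?card_ord.
- by rewrite !big1 //; lia.
- by rewrite !big1 //; lia.
- by rewrite (sum_pair_const _ [pred j : 'I_13 | arc 13 3 u.1 j]) card_arc_13 !big1 //; lia.
Qed.

Lemma card_cgraph k m : #|cgraph k m| = ((35 * k + 142) * m)%N.
Proof.
by rewrite !card_sum !card_prod !card_ord; lia.
Qed.

Lemma degree_cgraph k m (x : cgraph k m) :
  degree x = ((35 * k + 107) * m)%N.
Proof.
suff: (degree x)%:Z = ((35 * k + 107) * m)%N by case.
have -> : (degree x)%:Z = \sum_(y | cadj x y) (inA y + inB y + inC y).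
  rewrite (eq_bigr (fun=> 1)) => [|y _]; last exact: inABC.
  by rewrite sumr_const natz /degree; congr Posz; apply: eq_card => y; rewrite !inE.
rewrite !big_split /= nbr_inA nbr_inB nbr_inC.
(* Exactly one indicator of [x] is 1, so 35m is subtracted exactly once. *)
by have := inABC x; nia.
Qed.

(** * The dual certificate: negative on the graph, nonnegative on copies *)

(** The edge weights form a symmetric bilinear form in the indicators, so its sums depend only on
    vertex counts in A, B and C. *)
Definition cert k m (x y : cvertex k m) : int :=
  k%:Z * (inB x * inB y) + 3 * k%:Z * (inC x * inC y)
  - k%:Z * (inB x * inC y) - k%:Z * (inC x * inB y)
  + inA x * inB y - inA x * inC y + inB x * inA y - inC x * inA y.

Lemma sum_cert k m (x : cvertex k m) (P : pred (cvertex k m)) :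
  \sum_(y | P y) cert x y =
    (inB x - inC x) * (\sum_(y | P y) inA y)
  + (k%:Z * inB x - k%:Z * inC x + inA x) * (\sum_(y | P y) inB y)
  + (3 * k%:Z * inC x - k%:Z * inB x - inA x) * (\sum_(y | P y) inC y).
Proof.
rewrite !mulr_sumr -!big_split; apply: eq_bigr => y _ /=.
by rewrite /cert; ring.
Qed.

Lemma cert_total_lt0 k m : (0 < k)%N -> (0 < m)%N ->
  \sum_(x : cgraph k m) \sum_(y | adj x y) cert x y < 0.
Proof.
move=> k0 m0.
(* Weight seen from one vertex; for instance in C it is -35km - 77km + 3k * 30m = -22km. *)
rewrite (eq_bigr (fun x : cvertex k m =>
    inA x * (12 * m%:Z) + inB x * (12 * k%:Z * m%:Z) + inC x * (- 22 * k%:Z * m%:Z))); last first.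
  move=> x _; rewrite sum_cert nbr_inA nbr_inB nbr_inC.
  by case: x => [u|[u|u]] /=; ring.
rewrite !big_split -!mulr_suml sum_inA sum_inB sum_inC.
(* The constant is 35 * 12 + 77 * 12 - 65 * 22 = -86. *)
rewrite /= (_ : _ + _ = - (86 * k%:Z * m%:Z * m%:Z)); last by ring.
by rewrite oppr_lt0 !mulr_gt0.
Qed.

(** The form splits with coefficients k - a and a. Each bracket is a product of consecutive integers
    plus 2c(c - 2), which is negative only for c = 1. *)
Lemma cert_form_ge0 (k a b c : int) :
  0 <= a <= k -> 0 <= b -> 0 <= c -> a + b + c = k + 3 ->
  0 <= k * (b * b - b) + 3 * k * (c * c - c) - 2 * k * b * c + 2 * a * (b - c).
Proof.
move=> /andP[a0 ak] b0 c0 sum_abc.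
have -> : k * (b * b - b) + 3 * k * (c * c - c) - 2 * k * b * c + 2 * a * (b - c)
  = (k - a) * ((b - c) * (b - c - 1) + 2 * c * (c - 2))
    + a * ((b - c) * (b - c + 1) + 2 * c * (c - 2)) by ring.
have ge0 (d : int) : 0 <= d * (d - 1).
  have [d1|d0] : 1 <= d \/ d <= 0 by lia.
    by nia.
  by nia.
(* For c = 1, the bound a <= k forces b >= 2. If b = 2 then a = k and the form vanishes; if b >= 3
   the product is at least 2 and compensates. *)
have [c1|c1] : c = 1 \/ c <> 1 by lia.
  have [b1|b1] : b = 2 \/ 2 < b by lia.
    have -> : k = a by lia.
    by rewrite b1 c1; lia.
  by apply: addr_ge0; apply: mulr_ge0; rewrite ?subr_ge0 // c1; nia.
have c2 : 0 <= c * (c - 2).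
  have [->|c2] : c = 0 \/ 2 <= c by lia.
    by [].
  by nia.
apply: addr_ge0; apply: mulr_ge0; rewrite ?subr_ge0 //.
  by have := ge0 (b - c); lia.
by have := ge0 (b - c + 1); lia.
Qed.

(** A clique meets each of the k independent sets at most once, so [f] is injective on its vertices
    in A. *)
Lemma Kcopy_inA_le q k m (K : {set cgraph k m}) :
  K \in Kcopies q (cgraph k m) -> \sum_(x in K) inA x <= k%:Z.
Proof.
move=> KK.
pose f (x : cvertex k m) : option 'I_k := if x is inl u then Some u.1 else None.
pose A : {set cgraph k m} := [set x in K | f x].
have -> : \sum_(x in K) inA x = #|A|%:Z.
  transitivity (\sum_(x in A) (1 : int)); last by rewrite sumr_const natz.
  rewrite [RHS](eq_bigl (fun x => (x \in K) && f x)) => [|x]; last by rewrite inE.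
  by rewrite big_mkcondr; apply: eq_bigr => -[u|u] _.
rewrite lez_nat -[leqRHS]card_ord -cardsT -(card_imset [set: 'I_k] Some_inj).
rewrite -(card_in_imset (f := f)) => [|x y].
  apply/subset_leq_card/subsetP => o /imsetP[[u|u]]; rewrite inE andbC // => _ ->.
  exact/imset_f.
rewrite !inE => /andP[xK fx] /andP[yK fy] eq_f; apply/eqP; apply: contraT => neq_xy.
have := Kcopy_adj KK xK yK neq_xy.
by case: x y eq_f fx fy {xK yK neq_xy} => [u|u] [v|v] //= [->]; rewrite eqxx.
Qed.

Lemma cert_Kcopy_ge0 k m (K : {set cgraph k m}) :
  K \in Kcopies (k + 3) (cgraph k m) ->
  0 <= \sum_(x in K) \sum_(y in K | x != y) cert x y.
Proof.
move=> KK; have leA := Kcopy_inA_le KK.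
pose a := \sum_(x in K) inA x; pose b := \sum_(x in K) inB x; pose c := \sum_(x in K) inC x.
have abc : a + b + c = k%:Z + 3.
  rewrite /a /b /c -!big_split /= (eq_bigr (fun=> 1)) => [|x _]; last exact: inABC.
  by rewrite sumr_const natz; move: KK; rewrite inE => /andP[/eqP-> _]; lia.
have ge0 (i : cvertex k m -> int) : (forall x, 0 <= i x) -> 0 <= \sum_(x in K) i x.
  by move=> i0; apply: sumr_ge0.
have a0 : 0 <= a by apply: ge0 => -[|[]].
have b0 : 0 <= b by apply: ge0 => -[|[]].
have c0 : 0 <= c by apply: ge0 => -[|[]].
suff -> : \sum_(x in K) \sum_(y in K | x != y) cert x y =
    k%:Z * (b * b - b) + 3 * k%:Z * (c * c - c) - 2 * k%:Z * b * c + 2 * a * (b - c).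
  by apply: cert_form_ge0; rewrite ?a0.
rewrite (eq_bigr (fun x : cvertex k m => inA x * (b - c)
   + inB x * (k%:Z * b - k%:Z * c + a - k%:Z)
   + inC x * (3 * k%:Z * c - k%:Z * b - a - 3 * k%:Z))); last first.
  (* Summing over all of [K] and removing the diagonal term leaves the corrections -k in B and -3k
     in C. *)
  move=> x xK; transitivity (\sum_(y in K) cert x y - cert x x).
    by rewrite [in RHS](bigD1 x) //= addrAC subrr add0r; apply: eq_bigl => y; rewrite eq_sym.
  rewrite sum_cert -/a -/b -/c /cert.
  by case: x {xK} => [u|[u|u]] /=; ring.
by rewrite !big_split -!mulr_suml -/a -/b -/c /=; ring.
Qed.

(** * Divisibility, minimum degree and the infinite family *)

Lemma Kdivisible_cgraph q k m : (q * (q - 1) %| m)%N ->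
  Kdivisible q (cgraph k m).
Proof.
move=> qm; split=> [|x]; last first.
  by rewrite degree_cgraph dvdn_mull // (dvdn_trans _ qm) // dvdn_mull.
have := handshake (cgraph k m).
rewrite (eq_bigr (fun=> ((35 * k + 107) * m)%N)) => [|x _]; last exact: degree_cgraph.
rewrite sum_nat_const card_cgraph => eqE.
case/dvdnP: qm => t defm.
(* Both sides are compared after doubling, as the handshake identity gives twice the number of
   edges. *)
have binq : ('C(q, 2) * 2 = q * (q - 1))%N by rewrite bin_ffact ffactnS ffactn1 subn1.
apply/dvdnP; exists ((35 * k + 142) * (35 * k + 107) * m * t)%N.
apply: double_inj; rewrite -eqE -muln2 -!mulnA binq -defm.
by rewrite mulnCA; lia.
Qed.

Lemma min_degree_cgraph k m : ((35 * k + 107) * m <= min_degree (cgraph k m))%N.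
Proof.
rewrite /min_degree; elim/big_ind: _ => [|u v ? ?|x _].
(* The default value of the minimum, the number of vertices, must satisfy the bound too. *)
- by rewrite card_cgraph; nia.
- by rewrite leq_min; apply/andP.
- by rewrite degree_cgraph.
Qed.

Local Close Scope ring_scope.

Theorem theorem1p3 (R : realType) (q : nat) (hq : 4 <= q) :
  exists2 c : R, (1 < c)%R &
    infinitely_many (fun G : sgraph =>
      [/\ Kdivisible q G,
          ((1 - 1 / (c * (q + 1)%:R)) * #|G|%:R <= (min_degree G)%:R)%R,
          ~ has_Kdecomposition q G
        & ~ has_fractional_Kdecomposition R q G]).
Proof.
(* With k = q - 3, [n] is 35k + 142. The choice of c gives 1 / (c(q + 1)) = 35 / n, and c > 1
   because 37 > 35. *)
pose n := 35 * q + 37.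
exists (n%:R / (35 * (q + 1))%:R)%R.
  by rewrite ltr_pdivlMr ?mul1r ?ltr_nat ?ltr0n /n //; lia.
(* The factor q(q - 1) ensures divisibility; [i.+1] makes the graphs nonempty and of distinct
   orders. *)
pose k := q - 3; pose m i := q * (q - 1) * i.+1.
have defq : q = k + 3 by rewrite subnK // ltnW.
have k_gt0 : 0 < k by rewrite subn_gt0.
have m_gt0 i : 0 < m i by rewrite !muln_gt0 /=; lia.
exists (fun i => cgraph k (m i)); split=> [i|i j neq_ij]; last first.
  move/isomorphic_card; rewrite !card_cgraph => /eqP.
  rewrite eqn_pmul2l ?eqn_pmul2l ?addn_gt0 ?muln_gt0 ?orbT //=; last by lia.
  by move/eqP => [] /neq_ij.
have no_frac : ~ has_fractional_Kdecomposition R q (cgraph k (m i)).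
  apply: (@no_fractional_Kdecomposition R q (cgraph k (m i)) (@cert k (m i))); last exact: cert_total_lt0.
  by move=> K; rewrite [in X in Kcopies X]defq; apply: cert_Kcopy_ge0.
split=> //; first by apply: Kdivisible_cgraph; apply: dvdn_mulr.
  apply: le_trans (_ : ((35 * k + 107) * m i)%:R <= _)%R; last first.
    by rewrite ler_nat min_degree_cgraph.
  have -> : (35 * k + 107) * m i = n * m i - 35 * m i by rewrite /n; nia.
  rewrite card_cgraph (_ : 35 * k + 142 = n); last by rewrite /n; lia.
  rewrite natrB ?leq_mul2r; last by rewrite /n; lia.
  rewrite !natrM.
  have n0 : (n%:R != 0 :> R)%R by rewrite pnatr_eq0 /n; lia.
  have q0 : ((q + 1)%:R != 0 :> R)%R by rewrite pnatr_eq0; lia.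
  (* The degree is nm - 35m on nm vertices, so the bound is attained with equality. *)
  rewrite le_eqVlt; apply/orP; left; apply/eqP; field.
  by rewrite n0 natr1 -addn1 q0.
by move/(@fractional_of_decomposition R _ _ (ltnW (ltnW hq))).
Qed.
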